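(* Consider the overlapping generations economy with stocks and land described in the context. If the production function takes the CES form $$F(K,L)=\left(\alpha K^{1-1/\sigma}+(1-\alpha)L^{1-1/\sigma}\right)^{\frac{1}{1-1/\sigma}}$$ with $\alpha\in(0,1)$ and $0<\sigma<1$, and $$(K_t,L_t,D_t)=(K_0G_K^t,L_0G_L^t,D_0G_X^t)$$ with $K_0,L_0,D_0>0$ and $G_K,G_L,G_X>0$, then there is a bubble in the aggregate asset market if and only if $G_K>G_L>G_X$.
   Context: Time is $t=0,1,2,\dots$; the economy is deterministic with a homogeneous good and two-period-lived overlapping generations. Generation $t$ has utility $(1-\beta)\log y_t+\beta\log z_{t+1}$, $\beta\in(0,1)$, over consumption when young and old. The young supply all labor and earn the wage income; the old have no income other than from assets, and the initial old own all assets. Capital-intensive sector: a representative firm has production function $F(K,L)$. Capital and labor supplies $K_t,L_t>0$ are exogenous. The firm takes the rental rate $r_t>0$ and wage $w_t>0$ as given and maximizes $F(K,L)-r_tK-w_tL$, so $r_t=F_K(K_t,L_t)$, $w_t=F_L(K_t,L_t)$. A stock is a claim to capital rents; there are $N>0$ shares, the stock price is $Q_t>0$, and the dividend per share is $r_tK_t/N$. Land-intensive sector: a unit of land produces $D_t>0$ units of output (its dividend); aggregate land supply is $X>0$, the land price is $P_t>0$. Stocks and land are traded as long-lived assets by the young, who can hold both; the markets for stocks, land, and the good clear. No-arbitrage requires $$R_t:=\frac{Q_{t+1}+r_{t+1}K_{t+1}/N}{Q_t}=\frac{P_{t+1}+D_{t+1}}{P_t}.$$ The aggregate asset value is $S_t:=Q_tN+P_tX$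 and the aggregate dividend is $E_t:=r_tK_t+D_tX$. Let $q_0=1$, $q_t=1/\prod_{s=0}^{t-1}R_s$. There is a bubble in the aggregate asset market if, in equilibrium, $S_t>\frac{1}{q_t}\sum_{s=t+1}^\infty q_sE_s$ (equivalently, $\lim_{T\to\infty}q_TS_T>0$). *)

(* Defs.v *)
From Stdlib Require Import Reals.
From Coquelicot Require Import Coquelicot.
Open Scope R_scope.

Record economy := Economy {
  beta : R;                  (* utility weight on old-age consumption *)
  F : R -> R -> R;           (* production function F(K, L), used for K, L > 0 only *)
  capital : nat -> R;
  labor : nat -> R;
  land_dividend : nat -> R;
  shares : R;
  land : R
}.

(* [young t] and [old t] are the consumptions at date [t] of the agents who are
   young and old at that date: generation [t] consumes [young t], [old (S t)]. *)
Record outcome := Outcome {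
  rent : nat -> R;
  wage : nat -> R;
  stock_price : nat -> R;
  land_price : nat -> R;
  young : nat -> R;
  old : nat -> R;
  stock_holding : nat -> R;
  land_holding : nat -> R
}.

Definition stock_dividend (e : economy) (o : outcome) (t : nat) : R :=
  rent o t * capital e t / shares e.

(* Inputs range over the open orthant: [Rpower 0 _] is a junk value, so a CES
   formula is meaningless on the boundary. *)
Definition firm_optimal (e : economy) (o : outcome) (t : nat) (K L : R) : Prop :=
  0 < K /\ 0 < L /\
  forall K' L' : R, 0 < K' -> 0 < L' ->
    F e K' L' - rent o t * K' - wage o t * L'
      <= F e K L - rent o t * K - wage o t * L.

Definition utility (e : economy) (y z : R) : R :=
  (1 - beta e) * ln y + beta e * ln z.

(* Consumption must be positive: [ln] takes the junk value 0 at nonpositive reals. *)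
Definition feasible (e : economy) (o : outcome) (t : nat) (y z n x : R) : Prop :=
  0 < y /\ 0 < z /\
  y + stock_price o t * n + land_price o t * x = wage o t * labor e t /\
  z = (stock_price o (S t) + stock_dividend e o (S t)) * n
      + (land_price o (S t) + land_dividend e (S t)) * x.

Definition household_optimal (e : economy) (o : outcome) (t : nat) (y z n x : R) : Prop :=
  feasible e o t y z n x /\
  forall y' z' n' x' : R, feasible e o t y' z' n' x' ->
    utility e y' z' <= utility e y z.

Definition gross_return (e : economy) (o : outcome) (t : nat) : R :=
  (stock_price o (S t) + stock_dividend e o (S t)) / stock_price o t.

Definition no_arbitrage (e : economy) (o : outcome) (t : nat) : Prop :=
  gross_return e o t =
  (land_price o (S t) + land_dividend e (S t)) / land_price o t.

Record equilibrium (e : economy) (o : outcome) : Prop := {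
  eq_rent_pos : forall t, 0 < rent o t;
  eq_wage_pos : forall t, 0 < wage o t;
  eq_stock_price_pos : forall t, 0 < stock_price o t;
  eq_land_price_pos : forall t, 0 < land_price o t;
  eq_firm : forall t, firm_optimal e o t (capital e t) (labor e t);
  eq_household : forall t,
    household_optimal e o t (young o t) (old o (S t)) (stock_holding o t) (land_holding o t);
  eq_initial_old :
    old o 0%nat = (stock_price o 0%nat + stock_dividend e o 0%nat) * shares e
                  + (land_price o 0%nat + land_dividend e 0%nat) * land e;
  eq_no_arbitrage : forall t, no_arbitrage e o t;
  eq_stock_market : forall t, stock_holding o t = shares e;
  eq_land_market : forall t, land_holding o t = land e;
  eq_goods_market : forall t,
    young o t + old o t = F e (capital e t) (labor e t) + land_dividend e t * land e
}.

Definition asset_value (e : economy) (o : outcome) (t : nat) : R :=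
  stock_price o t * shares e + land_price o t * land e.

Definition total_dividend (e : economy) (o : outcome) (t : nat) : R :=
  rent o t * capital e t + land_dividend e t * land e.

Fixpoint compound_return (e : economy) (o : outcome) (t : nat) : R :=
  match t with
  | O => 1
  | S s => compound_return e o s * gross_return e o s
  end.

Definition discount (e : economy) (o : outcome) (t : nat) : R :=
  1 / compound_return e o t.

(* The dividends are positive in equilibrium, so a divergent series has value
   +oo; then there is no bubble, in agreement with the existential. *)
Definition aggregate_bubble (e : economy) (o : outcome) (t : nat) : Prop :=
  exists V : R,
    is_series (fun n : nat => discount e o (t + 1 + n) * total_dividend e o (t + 1 + n)) V /\
    asset_value e o t > 1 / discount e o t * V.

Definition CES (alpha sigma K L : R) : R :=
  Rpower (alpha * Rpower K (1 - 1 / sigma) + (1 - alpha) * Rpower L (1 - 1 / sigma))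
         (1 / (1 - 1 / sigma)).

Definition geometric (x0 G : R) (t : nat) : R := x0 * G ^ t.

(* Main.v *)
Require Import Defs.
From Stdlib Require Import Reals Lra.
From Coquelicot Require Import Coquelicot.
Open Scope R_scope.

(** With log utility the young save the fraction [beta] of their income, so the
    aggregate asset value is [S_t = beta w_t L_t].  The return identity
    [q_(t+1) (S_(t+1) + E_(t+1)) = q_t S_t] makes [q_t S_t] decrease by the factor
    [1 + E_t / S_t], and the series of discounted dividends telescopes to
    [q_t S_t - lim q_T S_T]; hence a bubble exists iff [E_t / S_t] is summable.
    Under CES with [p = 1 - 1/sigma < 0], the ratio [r_t K_t / (w_t L_t)] is a
    multiple of [(K_t / L_t)^p], and [w_t L_t] is at most a multiple of [L_t], and
    of that order when [G_K > G_L].  So [E_t / S_t] decays geometrically if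
    [G_K > G_L > G_X] and is bounded away from zero otherwise. *)

(** * Interior maxima and monotonicity of real powers *)

Lemma is_derive_interior_max (f : R -> R) (a b c l : R) :
  a < c < b -> (forall x, a < x < b -> f x <= f c) -> is_derive f c l -> l = 0.
Proof.
  intros [Hac Hcb] Hmax Hd.
  apply is_derive_Reals in Hd.
  pose (pr := exist _ l Hd : derivable_pt f c).
  rewrite <- (derive_pt_eq_0 f c l pr Hd).
  apply (deriv_maximum f a b c pr Hac Hcb). intros; apply Hmax; lra.
Qed.

Lemma exp_le_exp (x y : R) : x <= y -> exp x <= exp y.
Proof.
  intros [H | ->]; [left; now apply exp_increasing | lra].
Qed.

Lemma Rle_1_div (x y : R) : 0 < y -> y <= x -> 1 <= x / y.
Proof. intros Hy H. apply Rle_div_r; lra. Qed.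

Lemma Rdiv_lt_1 (x y : R) : 0 < y -> x < y -> x / y < 1.
Proof. intros Hy H. apply Rlt_div_l; lra. Qed.

Lemma Rpower_pos (x p : R) : 0 < Rpower x p.
Proof. apply exp_pos. Qed.

Lemma Rpower_mult_self (x p : R) : 0 < x -> Rpower x (p - 1) * x = Rpower x p.
Proof.
  intros Hx. rewrite <- (Rpower_1 x Hx) at 2. rewrite <- Rpower_plus.
  f_equal; ring.
Qed.

Lemma Rpower_geometric (x0 G p : R) (t : nat) : 0 < x0 -> 0 < G ->
  Rpower (geometric x0 G t) p = Rpower x0 p * Rpower G p ^ t.
Proof.
  intros Hx HG. unfold geometric.
  rewrite <- Rpower_mult_distr by (auto using pow_lt).
  f_equal. rewrite <- (Rpower_pow t G HG), <- (Rpower_pow t (Rpower G p)) by apply Rpower_pos.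
  rewrite !Rpower_mult. f_equal; ring.
Qed.

Lemma Rpower_antitone (x y p : R) : p <= 0 -> 0 < x <= y -> Rpower y p <= Rpower x p.
Proof.
  intros Hp [Hx Hxy]. unfold Rpower. apply exp_le_exp.
  assert (ln x <= ln y) by (apply ln_le; lra). nra.
Qed.

Lemma Rpower_strict_antitone (x y p : R) : p < 0 -> 0 < x < y -> Rpower y p < Rpower x p.
Proof.
  intros Hp [Hx Hxy]. unfold Rpower. apply exp_increasing.
  assert (ln x < ln y) by (apply ln_increasing; lra). nra.
Qed.

(** * Bubbles and dividend yields for an abstract asset value [v], dividend [E] and discount factor
    [q] *)

Section Valuation.

Variables v E q : nat -> R.
Hypothesis v_pos : forall t, 0 < v t.
Hypothesis E_pos : forall t, 0 < E t.
Hypothesis q_pos : forall t, 0 < q t.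
Hypothesis q_step : forall t, q (S t) * (v (S t) + E (S t)) = q t * v t.

Let bubble t := exists V : R,
  is_series (fun n => q (t + 1 + n)%nat * E (t + 1 + n)%nat) V /\ v t > 1 / q t * V.

Lemma discounted_dividends_sum (t n : nat) :
  sum_n (fun n => q (t + 1 + n)%nat * E (t + 1 + n)%nat) n
  = q t * v t - q (t + 1 + n)%nat * v (t + 1 + n)%nat.
Proof using q_step.
  induction n as [|n IH].
  - rewrite sum_O, Nat.add_0_r, Nat.add_1_r. generalize (q_step t). lra.
  - rewrite sum_Sn, IH. unfold plus; simpl.
    rewrite (Nat.add_succ_r (t + 1) n). generalize (q_step (t + 1 + n)). lra.
Qed.

(** A bubble keeps [q v] above the positive gap [q t * v t - V], because partial sums never exceed
    [V]. The yield bound then keeps the discounted dividends above a positive constant, so they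
    cannot tend to 0 as convergence requires. *)
Lemma no_bubble_of_dividend_yield_bound (c : R) (t : nat) :
  0 < c -> (forall s, c * v s <= E s) -> ~ bubble t.
Proof using v_pos E_pos q_pos q_step.
  intros Hc Hyield (V & HV & Hgt).
  assert (HVlt : V < q t * v t).
  { pose proof (q_pos t) as Hq. apply (Rmult_gt_compat_l (q t)) in Hgt; [|lra].
    replace (q t * (1 / q t * V)) with V in Hgt by (field; lra). lra. }
  assert (Hpos : forall n, 0 < q n * E n) by (intros; now apply Rmult_lt_0_compat).
  assert (Hpartial : forall n,
    sum_n (fun n => q (t + 1 + n)%nat * E (t + 1 + n)%nat) n <= V).
  { intros n. refine (is_lim_seq_incr_compare _ V HV _ n).
    intros m. rewrite sum_Sn. unfold plus; simpl. generalize (Hpos (t + 1 + S m)%nat). lra. }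
  assert (Hterm : forall n, c * (q t * v t - V) <= q (t + 1 + n)%nat * E (t + 1 + n)%nat).
  { intros n. specialize (Hpartial n). rewrite discounted_dividends_sum in Hpartial.
    specialize (Hyield (t + 1 + n)%nat). pose proof (q_pos (t + 1 + n)%nat) as Hq.
    apply Rle_trans with (q (t + 1 + n)%nat * (c * v (t + 1 + n)%nat)).
    - replace (q (t + 1 + n)%nat * (c * v (t + 1 + n)%nat))
        with (c * (q (t + 1 + n)%nat * v (t + 1 + n)%nat)) by ring.
      apply Rmult_le_compat_l; lra.
    - apply Rmult_le_compat_l; lra. }
  assert (Hlim := ex_series_lim_0 _ (ex_intro _ V HV)).
  assert (Hle := is_lim_seq_le _ _ _ _ Hterm (is_lim_seq_const _) Hlim).
  simpl in Hle. nra.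
Qed.

(** Each step divides [q v] by one plus the yield, which is at most the exponential of the yield
    bound. These bounds have a finite sum, so [q v] stays above some [A > 0], and the telescoped
    series leaves a gap of at least [A]. *)
Lemma bubble_of_geometric_dividend_yield (C rho : R) (t : nat) :
  0 <= C -> 0 < rho < 1 -> (forall s, E s <= C * rho ^ s * v s) -> bubble t.
Proof using v_pos E_pos q_pos q_step.
  intros HC Hrho Hyield.
  (* [b] is a tail bound for the yields: [b s - b (s+1) = C rho^(s+1)]. *)
  pose (b := fun s => C * rho ^ S s / (1 - rho)).
  pose (A := q 0%nat * v 0%nat * exp (- b 0%nat)).
  assert (HqS : forall s, 0 < q s * v s) by (intros; now apply Rmult_lt_0_compat).
  assert (HA : 0 < A) by (apply Rmult_lt_0_compat; [apply HqS | apply exp_pos]).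
  (* [A] is chosen to give equality at 0. In the induction step the loss factor, at most [exp a], is
     absorbed by the drop [a] from [b s] to [b (S s)]. *)
  assert (Hinv : forall s, A * exp (b s) <= q s * v s).
  { induction s as [|s IH].
    - unfold A. rewrite Rmult_assoc, <- exp_plus.
      replace (- b 0%nat + b 0%nat) with 0 by ring. rewrite exp_0. lra.
    - set (a := C * rho ^ S s).
      assert (Hb : b s = b (S s) + a) by (unfold b, a; simpl; field; lra).
      rewrite Hb, exp_plus, <- q_step in IH.
      specialize (Hyield (S s)). fold a in Hyield.
      pose proof (q_pos (S s)) as Hq.
      assert (Hgrow : q (S s) * (v (S s) + E (S s))
                      <= q (S s) * v (S s) * exp a).
      { rewrite Rmult_assoc. apply Rmult_le_compat_l; [lra|].
        pose proof (exp_ineq1_le a). specialize (v_pos (S s)). nra. }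
      apply Rmult_le_reg_r with (exp a); [apply exp_pos | lra]. }
  assert (Hfloor : forall s, A <= q s * v s).
  { intros s. apply Rle_trans with (2 := Hinv s).
    assert (0 <= b s).
    { unfold b. apply Rdiv_le_0_compat; [|lra].
      apply Rmult_le_pos; [lra | apply pow_le; lra]. }
    pose proof (exp_ineq1_le (b s)). nra. }
  assert (Hbound : forall n,
    sum_n (fun n => q (t + 1 + n)%nat * E (t + 1 + n)%nat) n <= q t * v t - A).
  { intros n. rewrite discounted_dividends_sum. specialize (Hfloor (t + 1 + n)%nat). lra. }
  destruct (ex_finite_lim_seq_incr
    (sum_n (fun n => q (t + 1 + n)%nat * E (t + 1 + n)%nat)) (q t * v t - A)) as [V HV].
  - intros n. rewrite sum_Sn. unfold plus; simpl.
    assert (0 < q (t + 1 + S n)%nat * E (t + 1 + S n)%nat)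
      by now apply Rmult_lt_0_compat.
    lra.
  - exact Hbound.
  - exists V. split; [exact HV|].
    assert (HVle := is_lim_seq_le _ _ _ _ Hbound HV (is_lim_seq_const _)). simpl in HVle.
    pose proof (q_pos t) as Hq.
    apply Rmult_gt_reg_l with (q t); [lra|].
    replace (q t * (1 / q t * V)) with V by (field; lra). lra.
Qed.

End Valuation.

(** * Marginal products of the CES function *)

Definition CES_aggregate (a p K L : R) : R := a * Rpower K p + (1 - a) * Rpower L p.

Lemma CES_aggregate_pos (a p K L : R) : 0 < a < 1 -> 0 < CES_aggregate a p K L.
Proof.
  intros Ha. unfold CES_aggregate.
  pose proof (Rpower_pos K p). pose proof (Rpower_pos L p). nra.
Qed.

Lemma CES_sym (a s K L : R) : CES a s K L = CES (1 - a) s L K.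
Proof. unfold CES. f_equal. ring. Qed.

Lemma is_derive_CES (a s K L : R) (p := 1 - 1 / s) :
  0 < a < 1 -> p <> 0 -> 0 < K ->
  is_derive (fun k => CES a s k L) K
    (a * Rpower K (p - 1) * Rpower (CES_aggregate a p K L) (1 / p - 1)).
Proof.
  intros Ha Hp HK.
  assert (HM := CES_aggregate_pos a p K L Ha).
  assert (Hpow : forall x r, 0 < x -> is_derive (fun y => Rpower y r) x (r * Rpower x (r - 1))).
  { intros x r Hx. apply is_derive_Reals. now apply derivable_pt_lim_power. }
  assert (Hin : is_derive (fun k => CES_aggregate a p k L) K (a * (p * Rpower K (p - 1)))).
  { unfold CES_aggregate.
    (* The labor term is constant in [k] and contributes the zero summand. *)
    rewrite <- (plus_zero_r (a * (p * Rpower K (p - 1)))).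
    apply @is_derive_plus; [|apply @is_derive_const].
    apply is_derive_scal. now apply Hpow. }
  assert (H := is_derive_comp _ (fun k => CES_aggregate a p k L) _ _ _ (Hpow _ (1 / p) HM) Hin).
  unfold CES. fold p. unfold CES_aggregate in *.
  replace (a * Rpower K (p - 1) * _)
    with (scal (a * (p * Rpower K (p - 1)))
      (1 / p * Rpower (a * Rpower K p + (1 - a) * Rpower L p) (1 / p - 1))); [exact H|].
  unfold scal; simpl; unfold mult; simpl. field. exact Hp.
Qed.

(** The first-order condition equates [r] with the marginal product; multiplying by [K] turns the
    exponent [p - 1] into [p]. *)
Lemma CES_factor_income (a s K L r : R) (p := 1 - 1 / s) :
  0 < a < 1 -> p <> 0 -> 0 < K ->
  (forall k, 0 < k -> CES a s k L - r * k <= CES a s K L - r * K) ->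
  r * K = a * Rpower K p * Rpower (CES_aggregate a p K L) (1 / p - 1).
Proof.
  intros Ha Hp HK Hmax.
  assert (Hd := is_derive_CES a s K L Ha Hp HK). fold p in Hd.
  set (d := _ * _ * _) in Hd.
  assert (Hd' : is_derive (fun k => CES a s k L - r * k) K (d - r)).
  { apply @is_derive_minus; [exact Hd|].
    auto_derive; [exact I | ring]. }
  apply (is_derive_interior_max _ 0 (K + 1)) in Hd'; [|lra | intros; apply Hmax; lra].
  replace r with d by lra. unfold d.
  rewrite <- (Rpower_mult_self K p HK). ring.
Qed.

(** * Saving, returns and discounting in equilibrium *)

(** By market clearing the young hold the whole asset supply, at cost [A]. Rescaling this portfolio
    scales old consumption proportionally, so log utility yields [(1 - beta) A = beta y]; combine
    with [y + A = w L]. *)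
Lemma asset_value_wage_share (e : economy) (o : outcome) (t : nat) :
  equilibrium e o -> 0 < beta e < 1 -> 0 < shares e -> 0 < land e ->
  asset_value e o t = beta e * (wage o t * labor e t).
Proof.
  intros ho Hb HN HX.
  destruct (eq_household e o ho t) as [Hf Hopt].
  rewrite (eq_stock_market e o ho t), (eq_land_market e o ho t) in *.
  destruct Hf as (Hy & Hz & Hyb & Hzb).
  set (y := young o t) in *. set (z := old o (S t)) in *.
  set (A := asset_value e o t).
  assert (HA : 0 < A).
  { apply Rplus_lt_0_compat; apply Rmult_lt_0_compat; trivial;
      [apply (eq_stock_price_pos e o ho) | apply (eq_land_price_pos e o ho)]. }
  assert (HyA : y + A = wage o t * labor e t) by (rewrite <- Hyb; unfold A, asset_value; ring).
  (* First-order condition for rescaling the whole portfolio by [1 + d]. *)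
  assert (Hd : is_derive (fun d => utility e (y - d * A) ((1 + d) * z)) 0
                 (- (1 - beta e) * A / y + beta e)).
  { unfold utility. auto_derive; [repeat split; nra | field; lra]. }
  (* Above [-1] old consumption stays positive; below [y / A] young consumption does. *)
  apply (is_derive_interior_max _ (-1) (y / A)) in Hd.
  - apply (f_equal (fun u => u * y)) in Hd.
    replace ((- (1 - beta e) * A / y + beta e) * y)
      with (beta e * (y + A) - A) in Hd by (field; lra).
    rewrite HyA in Hd. lra.
  - split; [lra | now apply Rdiv_lt_0_compat].
  - intros d [Hd1 Hd2].
    replace (y - 0 * A) with y by ring. replace ((1 + 0) * z) with z by ring.
    apply (Hopt _ _ ((1 + d) * shares e) ((1 + d) * land e)).
    apply Rmult_lt_compat_r with (r := A) in Hd2; [|exact HA].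
    replace (y / A * A) with y in Hd2 by (field; lra).
    repeat split; [lra | nra | |].
    + rewrite <- HyA. unfold A, asset_value. ring.
    + rewrite Hzb. ring.
Qed.

Lemma gross_return_pos (e : economy) (o : outcome) (t : nat) :
  equilibrium e o -> 0 < shares e -> (forall s, 0 < capital e s) -> 0 < gross_return e o t.
Proof.
  intros ho HN HK. unfold gross_return, stock_dividend.
  apply Rdiv_lt_0_compat; [|now apply (eq_stock_price_pos e o ho)].
  apply Rplus_lt_0_compat; [now apply (eq_stock_price_pos e o ho)|].
  apply Rdiv_lt_0_compat; [|exact HN].
  apply Rmult_lt_0_compat; [now apply (eq_rent_pos e o ho) | apply HK].
Qed.

Lemma discount_pos (e : economy) (o : outcome) (t : nat) :
  equilibrium e o -> 0 < shares e -> (forall s, 0 < capital e s) -> 0 < discount e o t.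
Proof.
  intros ho HN HK. unfold discount. apply Rdiv_lt_0_compat; [lra|].
  induction t as [|t IH]; simpl; [lra|].
  apply Rmult_lt_0_compat; [exact IH | now apply gross_return_pos].
Qed.

(** By no-arbitrage stocks and land earn the same gross return, hence so does their sum, and the
    discount factor falls by exactly this return. *)
Lemma discount_asset_value_step (e : economy) (o : outcome) (t : nat) :
  equilibrium e o -> 0 < shares e -> (forall s, 0 < capital e s) ->
  discount e o (S t) * (asset_value e o (S t) + total_dividend e o (S t))
  = discount e o t * asset_value e o t.
Proof.
  intros ho HN HK.
  pose proof (gross_return_pos e o t ho HN HK) as HR.
  pose proof (discount_pos e o t ho HN HK) as Hq.
  pose proof (eq_stock_price_pos e o ho t) as HQ.
  pose proof (eq_land_price_pos e o ho t) as HP.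
  assert (HRS : gross_return e o t * asset_value e o t
                = asset_value e o (S t) + total_dividend e o (S t)).
  { unfold asset_value at 1. rewrite Rmult_plus_distr_l.
    rewrite (eq_no_arbitrage e o ho t) at 2.
    unfold gross_return, stock_dividend, asset_value, total_dividend. field. lra. }
  rewrite <- HRS. unfold discount in *. simpl.
  (* Since [/ 0 = 0], a zero compound return would give a zero discount factor. *)
  assert (compound_return e o t <> 0).
  { intros H0. rewrite H0 in Hq. unfold Rdiv in Hq. rewrite Rinv_0 in Hq. lra. }
  field. lra.
Qed.

Lemma geometric_pos (x0 G : R) (t : nat) : 0 < x0 -> 0 < G -> 0 < geometric x0 G t.
Proof. intros. apply Rmult_lt_0_compat; auto using pow_lt. Qed.

(** * Factor incomes of a CES firm and bounds on the wage bill *)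

Section CES_incomes.

Variables a s K L r w : R.
Let p := 1 - 1 / s.
Hypothesis Ha : 0 < a < 1.
Hypothesis Hp : p < 0.
Hypothesis HK : 0 < K.
Hypothesis HL : 0 < L.
Hypothesis Hfirm : forall K' L', 0 < K' -> 0 < L' ->
  CES a s K' L' - r * K' - w * L' <= CES a s K L - r * K - w * L.

Lemma CES_rental_income :
  r * K = a * Rpower K p * Rpower (CES_aggregate a p K L) (1 / p - 1).
Proof using Ha Hp HK HL Hfirm.
  apply CES_factor_income; [exact Ha | fold p; lra | exact HK |].
  intros k Hk. specialize (Hfirm k L Hk HL). lra.
Qed.

(** [CES_sym] exchanges the inputs and their weights, so labor can be treated as capital was. *)
Lemma CES_wage_income :
  w * L = (1 - a) * Rpower L p * Rpower (CES_aggregate a p K L) (1 / p - 1).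
Proof using Ha Hp HK HL Hfirm.
  replace (CES_aggregate a p K L) with (CES_aggregate (1 - a) p L K)
    by (unfold CES_aggregate; ring).
  apply CES_factor_income; [lra | fold p; lra | exact HL |].
  intros l Hl. rewrite <- !CES_sym. specialize (Hfirm K l HK Hl). lra.
Qed.

(** Both incomes carry the same power of the aggregate, which cancels. *)
Lemma CES_rental_wage_ratio :
  r * K = a / (1 - a) * (Rpower K p / Rpower L p) * (w * L).
Proof using Ha Hp HK HL Hfirm.
  rewrite CES_rental_income, CES_wage_income.
  pose proof (Rpower_pos L p). field. lra.
Qed.

(** The exponents of [L] add up to 1. Replacing the aggregate by a multiple of [Rpower L p] thus
    makes wage income linear in [L]. *)
Lemma Rpower_dual_exponent (m : R) : 0 < m ->
  Rpower L p * Rpower (m * Rpower L p) (1 / p - 1) = Rpower m (1 / p - 1) * L.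
Proof using Hp HL.
  intros Hm. rewrite <- Rpower_mult_distr by (exact Hm || apply Rpower_pos).
  rewrite Rpower_mult, (Rmult_comm (Rpower m _)), <- Rmult_assoc, <- Rpower_plus.
  replace (p + p * (1 / p - 1)) with 1 by (field; lra).
  rewrite Rpower_1 by exact HL. ring.
Qed.

(** Dropping the capital term shrinks the aggregate, and its exponent [1 / p - 1] is negative. *)
Lemma CES_wage_income_upper : w * L <= (1 - a) * Rpower (1 - a) (1 / p - 1) * L.
Proof using Ha Hp HK HL Hfirm.
  rewrite CES_wage_income, !Rmult_assoc, <- Rpower_dual_exponent by lra.
  apply Rmult_le_compat_l; [lra|]. apply Rmult_le_compat_l; [left; apply Rpower_pos|].
  pose proof (Rpower_pos K p). pose proof (Rpower_pos L p).
  apply Rpower_antitone.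
  - assert (1 / p < 0) by (apply Rdiv_pos_neg; lra). lra.
  - unfold CES_aggregate. nra.
Qed.

(** The hypothesis bounds the aggregate by [(a * k + (1 - a)) * Rpower L p]; the negative exponent
    reverses the inequality. *)
Lemma CES_wage_income_lower (k : R) : Rpower K p <= k * Rpower L p ->
  (1 - a) * Rpower (a * k + (1 - a)) (1 / p - 1) * L <= w * L.
Proof using Ha Hp HK HL Hfirm.
  intros Hk. pose proof (Rpower_pos K p). pose proof (Rpower_pos L p).
  assert (0 < k) by nra.
  rewrite CES_wage_income, !Rmult_assoc, <- Rpower_dual_exponent by nra.
  apply Rmult_le_compat_l; [lra|]. apply Rmult_le_compat_l; [lra|].
  apply Rpower_antitone.
  - assert (1 / p < 0) by (apply Rdiv_pos_neg; lra). lra.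
  - split; [now apply CES_aggregate_pos | unfold CES_aggregate; nra].
Qed.

End CES_incomes.

(** * Growth rates and the existence of a bubble *)

Theorem proposition6p2
  (beta alpha sigma N X K0 L0 D0 GK GL GX : R)
  (hbeta : 0 < beta < 1) (halpha : 0 < alpha < 1) (hsigma : 0 < sigma < 1)
  (hN : 0 < N) (hX : 0 < X)
  (hK0 : 0 < K0) (hL0 : 0 < L0) (hD0 : 0 < D0)
  (hGK : 0 < GK) (hGL : 0 < GL) (hGX : 0 < GX)
  (e : economy)
  (he : e = Economy beta (CES alpha sigma)
              (geometric K0 GK) (geometric L0 GL) (geometric D0 GX) N X)
  (o : outcome) (ho : equilibrium e o) (t : nat) :
  aggregate_bubble e o t <-> (GK > GL /\ GL > GX).
Proof.
  set (p := 1 - 1 / sigma).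
  assert (Hp : p < 0).
  { unfold p. apply Rmult_lt_reg_r with sigma; [lra|].
    replace ((1 - 1 / sigma) * sigma) with (sigma - 1) by (field; lra). lra. }
  assert (HK : forall s, 0 < capital e s) by (intros; subst e; now apply geometric_pos).
  assert (HL : forall s, 0 < labor e s) by (intros; subst e; now apply geometric_pos).
  assert (HD : forall s, 0 < land_dividend e s) by (intros; subst e; now apply geometric_pos).
  assert (HN : 0 < shares e) by now subst e.
  assert (HX : 0 < land e) by now subst e.
  assert (HW : forall s, 0 < wage o s * labor e s).
  { intros s. apply Rmult_lt_0_compat; [apply (eq_wage_pos e o ho) | apply HL]. }
  assert (HS : forall s, asset_value e o s = beta * (wage o s * labor e s)).
  { intros s. rewrite (asset_value_wage_share e o s) by (auto; now subst e). now subst e. }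
  assert (HSpos : forall s, 0 < asset_value e o s).
  { intros s. rewrite HS. apply Rmult_lt_0_compat; [lra | apply HW]. }
  assert (HE : forall s, 0 < total_dividend e o s).
  { intros s. apply Rplus_lt_0_compat; apply Rmult_lt_0_compat; auto.
    apply (eq_rent_pos e o ho). }
  assert (Hq : forall s, 0 < discount e o s) by (intros; now apply discount_pos).
  assert (Hstep := fun s => discount_asset_value_step e o s ho HN HK).
  assert (Hfirm : forall s K' L', 0 < K' -> 0 < L' ->
    CES alpha sigma K' L' - rent o s * K' - wage o s * L' <=
    CES alpha sigma (capital e s) (labor e s) - rent o s * capital e s - wage o s * labor e s).
  { intros s. destruct (eq_firm e o ho s) as (_ & _ & H).
    intros K' L' HK' HL'. specialize (H K' L' HK' HL'). now subst e. }
  (* [kappa] is the growth factor of the rent-to-wage income ratio; as [p < 0], it is below 1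
     exactly when [GK > GL]. *)
  set (kappa := Rpower GK p / Rpower GL p).
  set (k0 := Rpower K0 p / Rpower L0 p).
  assert (Hk0 : 0 < k0) by (apply Rdiv_lt_0_compat; apply Rpower_pos).
  assert (Hkappa : 0 < kappa) by (apply Rdiv_lt_0_compat; apply Rpower_pos).
  assert (HKL : forall s, Rpower (capital e s) p / Rpower (labor e s) p = k0 * kappa ^ s).
  { intros s. subst e; simpl. rewrite !Rpower_geometric by assumption.
    unfold k0, kappa. unfold Rdiv. rewrite !Rpow_mult_distr, !pow_inv.
    pose proof (Rpower_pos L0 p). pose proof (pow_lt _ s (Rpower_pos GL p)).
    field. lra. }
  set (c1 := alpha / (1 - alpha) * k0).
  assert (Hc1 : 0 < c1).
  { apply Rmult_lt_0_compat; [apply Rdiv_lt_0_compat; lra | exact Hk0]. }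
  assert (Hrent : forall s,
    rent o s * capital e s = c1 * kappa ^ s * (wage o s * labor e s)).
  { intros s.
    rewrite (CES_rental_wage_ratio alpha sigma (capital e s) (labor e s) (rent o s) (wage o s))
      by auto.
    fold p. rewrite HKL. unfold c1. ring. }
  set (d0 := D0 * X / L0).
  assert (Hd0 : 0 < d0) by (apply Rdiv_lt_0_compat; [now apply Rmult_lt_0_compat | exact hL0]).
  assert (HDL : forall s, land_dividend e s * land e = d0 * (GX / GL) ^ s * labor e s).
  { intros s. subst e; simpl. unfold geometric, d0. unfold Rdiv. rewrite !Rpow_mult_distr, !pow_inv.
    pose proof (pow_lt GL s hGL). field. lra. }
  split.
  - intros Hbub.
    assert (Hno : forall c, 0 < c ->
      ~ (forall s, c * asset_value e o s <= total_dividend e o s)).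
    { intros c Hc Hyield.
      exact (no_bubble_of_dividend_yield_bound _ _ _ HSpos HE Hq Hstep c t Hc Hyield Hbub). }
    split; apply Rnot_le_gt; intros Hle.
    (* If [GK <= GL], then [kappa >= 1] and rents alone are at least [c1] times the wage bill, that
       is [c1 / beta] times the asset value. *)
    + apply (Hno (c1 / beta)); [apply Rdiv_lt_0_compat; lra|]. intros s.
      rewrite HS.
      replace (c1 / beta * (beta * (wage o s * labor e s)))
        with (c1 * (wage o s * labor e s)) by (field; lra).
      assert (1 <= kappa).
      { unfold kappa. apply Rle_1_div; [apply Rpower_pos|].
        apply Rpower_antitone; lra. }
      assert (1 <= kappa ^ s) by now apply pow_R1_Rle.
      unfold total_dividend. rewrite Hrent.
      assert (0 < land_dividend e s * land e) by now apply Rmult_lt_0_compat.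
      assert (c1 * (wage o s * labor e s) <= c1 * kappa ^ s * (wage o s * labor e s)); [|lra].
      apply Rmult_le_compat_r; [left; apply HW | nra].
    (* If [GL <= GX], land dividends are at least [d0] per unit of labor, while the asset value is
       at most [beta * u] per unit of labor. *)
    + set (u := (1 - alpha) * Rpower (1 - alpha) (1 / p - 1)).
      assert (Hu : 0 < u) by (apply Rmult_lt_0_compat; [lra | apply Rpower_pos]).
      apply (Hno (d0 / (beta * u))).
      { apply Rdiv_lt_0_compat; [exact Hd0 | apply Rmult_lt_0_compat; lra]. }
      intros s. rewrite HS.
      assert (HWu : wage o s * labor e s <= u * labor e s)
        by (apply (CES_wage_income_upper alpha sigma (capital e s) _ (rent o s)); auto).
      replace (d0 / (beta * u) * (beta * (wage o s * labor e s)))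
        with (d0 / u * (wage o s * labor e s)) by (field; lra).
      assert (1 <= (GX / GL) ^ s).
      { apply pow_R1_Rle. now apply Rle_1_div. }
      unfold total_dividend. rewrite HDL.
      assert (0 < rent o s * capital e s).
      { apply Rmult_lt_0_compat; [apply (eq_rent_pos e o ho) | apply HK]. }
      apply Rle_trans with (d0 * labor e s).
      * replace (d0 * labor e s) with (d0 / u * (u * labor e s)) by (field; lra).
        apply Rmult_le_compat_l; [left; now apply Rdiv_lt_0_compat | exact HWu].
      * specialize (HL s).
        assert (d0 * labor e s <= d0 * (GX / GL) ^ s * labor e s); [|lra].
        apply Rmult_le_compat_r; [lra | nra].
  - intros [HKL1 HLX].
    assert (Hkappa1 : kappa < 1).
    { unfold kappa. apply Rdiv_lt_1; [apply Rpower_pos|].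
      apply Rpower_strict_antitone; lra. }
    assert (Hlambda : 0 < GX / GL < 1).
    { split; [now apply Rdiv_lt_0_compat | apply Rdiv_lt_1; lra]. }
    (* With [kappa < 1] the ratio of powers never exceeds its initial value [k0], so the wage bill
       per unit of labor is at least [v]. *)
    set (v := (1 - alpha) * Rpower (alpha * k0 + (1 - alpha)) (1 / p - 1)).
    assert (Hv : 0 < v) by (apply Rmult_lt_0_compat; [lra | apply Rpower_pos]).
    assert (HWv : forall s, v * labor e s <= wage o s * labor e s).
    { intros s. apply (CES_wage_income_lower alpha sigma (capital e s) _ (rent o s)); auto.
      fold p. pose proof (Rpower_pos (labor e s) p) as Hpos.
      replace (Rpower (capital e s) p) with
        (Rpower (capital e s) p / Rpower (labor e s) p * Rpower (labor e s) p)
        by (field; lra).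
      apply Rmult_le_compat_r; [lra|]. rewrite HKL.
      assert (kappa ^ s <= 1 ^ s) by (apply pow_incr; lra).
      rewrite pow1 in *. nra. }
    (* The rent yield decays like [kappa] and the land yield at least as fast as [GX / GL]; the
       slower of these rates bounds both. *)
    set (rho := Rmax kappa (GX / GL)).
    assert (Hrho : 0 < rho < 1).
    { split; [apply Rlt_le_trans with (1 := Hkappa), Rmax_l | now apply Rmax_lub_lt]. }
    assert (HC1 : 0 < c1 / beta) by (apply Rdiv_lt_0_compat; lra).
    assert (HC2 : 0 < d0 / (v * beta)).
    { apply Rdiv_lt_0_compat; [exact Hd0 | apply Rmult_lt_0_compat; lra]. }
    apply (bubble_of_geometric_dividend_yield _ _ _ HSpos HE Hq Hstep
             (c1 / beta + d0 / (v * beta)) rho t); [lra | exact Hrho |].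
    intros s. rewrite HS. unfold total_dividend. rewrite Hrent, HDL.
    replace ((c1 / beta + d0 / (v * beta)) * rho ^ s * (beta * (wage o s * labor e s)))
      with (c1 * rho ^ s * (wage o s * labor e s)
            + d0 * rho ^ s * (wage o s * labor e s / v)) by (field; lra).
    assert (Hk : kappa ^ s <= rho ^ s) by (apply pow_incr; split; [lra | apply Rmax_l]).
    assert (Hl : (GX / GL) ^ s <= rho ^ s) by (apply pow_incr; split; [lra | apply Rmax_r]).
    specialize (HL s). specialize (HW s). specialize (HWv s).
    apply Rplus_le_compat.
    + apply Rmult_le_compat_r; [lra|]. apply Rmult_le_compat_l; lra.
    + apply Rmult_le_compat.
      * apply Rmult_le_pos; [lra | apply pow_le; lra].
      * lra.
      * apply Rmult_le_compat_l; lra.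
      * apply Rmult_le_reg_r with v; [exact Hv|].
        replace (wage o s * labor e s / v * v) with (wage o s * labor e s) by (field; lra). lra.
Qed.
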